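(* Let $k \ge 2$, $n = 2k$, and let $x = (x_1,\dots,x_n)$ be a position of the game Exact $k$-Nim on $2k$ piles, $\mathrm{Nim}^{=}_{2k,k}$. Set \begin{align*} u(x) &= T_{2k,k}(x),\\ m(x) &= \min_{1\le i\le 2k} x_i,\\ y(x) &= T_{2k,k}\big(x_1 - m(x), \ldots, x_{2k} - m(x)\big),\\ z(x) &= 1+\binom{y(x)+1}{2},\\ v(x) &= \big(z(x)-1\big) +\Big[\big(m(x)-z(x)\big) \bmod \big(y(x)+1\big)\Big]. \end{align*} Then the Sprague-Grundy function of $\mathrm{Nim}^{=}_{2k,k}$ is given by $$\mathcal{G}(x) = \begin{cases} u(x), & \text{if } m(x) < z(x);\\ v(x), & \text{if } m(x) \ge z(x).\end{cases}$$
   Context: $\mathbb{Z}_{\ge}$ denotes the set of nonnegative integers. For integers $1 \le k \le n$, Exact $k$-Nim, denoted $\mathrm{Nim}^{=}_{n,k}$, is the following impartial game. A position is a vector $x=(x_1,\dots,x_n) \in \mathbb{Z}_{\ge}^n$, where $x_i$ is the number of tokens in pile $i$. A move $x \to x'$ consists of choosing exactly $k$ piles and removing an arbitrary positive number of tokens from each of them. The game terminates when there are fewer than $k$ nonempty piles; the player who makes the last move wins. The Sprague-Grundy function is defined recursively by $\mathcal{G}(x) = \operatorname{mex}\{\mathcal{G}(y) \mid x \to y\}$, where $\operatorname{mex}(S)$ is the smallest nonnegative integer not in $S$ (and $\operatorname{mex}(\emptyset)=0$). The Tetris function value $T_{n,k}(x)$ is the maximum number of consecutive moves of $\mathrm{Nim}^{=}_{n,k}$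 that can be made starting from $x$. For integers $a$ and $b\ge 1$, $a \bmod b$ is the residue of $a$ in $\{0,\dots,b-1\}$. *)

(* Defs.v *)
From mathcomp Require Import all_boot.

Set Implicit Arguments.
Unset Strict Implicit.
Unset Printing Implicit Defensive.

Definition position (n : nat) := {ffun 'I_n -> nat}.

Definition move (n k : nat) : rel (position n) :=
  fun x y => [forall i, y i <= x i] && (#|[set i | y i < x i]| == k).

Definition options (n k : nat) (x : position n) : seq (position n) :=
  [seq y <- [seq [ffun i => f i : nat] | f : {dffun forall i, 'I_(x i).+1}]
     | move k x y].

Lemma mem_options (n k : nat) (x y : position n) :
  (y \in options k x) = move k x y.
Proof.
rewrite mem_filter andb_idr // => /andP[/forallP le_yx _].
apply/mapP; exists [ffun i => inord (y i)]; first by rewrite mem_enum.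
by apply/ffunP=> i; rewrite !ffunE inordK // ltnS.
Qed.

Lemma move_sum (n k : nat) (x y : position n) :
  0 < k -> move k x y -> \sum_i y i < \sum_i x i.
Proof.
move=> k_gt0 /andP[/forallP le_yx /eqP cardk].
have /card_gt0P[i] : 0 < #|[set i | y i < x i]| by rewrite cardk.
rewrite inE => lt_yx; rewrite (bigD1 i) //= [X in _ < X](bigD1 i) //=.
by rewrite -addSn leq_add // leq_sum.
Qed.

Lemma mex_subproof (s : seq nat) : exists v, v \notin s.
Proof.
exists (\max_(v <- s) v).+1; apply/negP=> s_max.
by have := @leq_bigmax_seq nat s predT id _ s_max isT; rewrite ltnn.
Qed.

Definition mex (s : seq nat) : nat := ex_minn (mex_subproof s).

(* The recursion is bounded by the number of tokens, which decreases along
   every move when [0 < k]; [sgE] is the unbounded recursion.  For [k = 0] the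
   game does not terminate and the value is meaningless. *)
Fixpoint sg_rec (n k t : nat) (x : position n) : nat :=
  if t is t'.+1 then mex [seq sg_rec k t' y | y <- options k x] else 0.

Definition sg (n k : nat) (x : position n) : nat := sg_rec k (\sum_i x i) x.

Lemma sgE (n k : nat) (x : position n) :
  0 < k -> sg k x = mex [seq sg k y | y <- options k x].
Proof.
move=> k_gt0.
have mex0 : mex [::] = 0.
  by rewrite /mex; case: ex_minnP => m _ /(_ 0 isT); rewrite leqn0 => /eqP.
have opt0 (z : position n) : \sum_i z i = 0 -> options k z = [::].
  move=> z0; apply/eqP; rewrite -[_ == _]negbK -size_eq0 -lt0n -has_predT.
  by apply/hasPn=> y; rewrite mem_options => /(move_sum k_gt0); rewrite z0.
have stable t : forall z : position n, \sum_i z i <= t ->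
    sg_rec k t z = sg_rec k (\sum_i z i) z.
  elim/ltn_ind: t => -[|t] IH z le_zt.
    by move: le_zt; rewrite leqn0 => /eqP ->.
  case def_s: (\sum_i z i) => [|s] /=; first by rewrite opt0.
  congr mex; apply/eq_in_map => y; rewrite mem_options => /(move_sum k_gt0).
  rewrite def_s ltnS => le_ys; move: le_zt; rewrite def_s ltnS => le_st.
  rewrite (IH t) ?(leq_trans le_ys) //.
  by rewrite (IH s) // ltnS.
rewrite {1}/sg; case def_s: (\sum_i x i) => [|s] /=; first by rewrite opt0.
congr mex; apply/eq_in_map => y; rewrite mem_options => /(move_sum k_gt0).
by rewrite def_s ltnS => le_ys; rewrite (stable s).
Qed.

Fixpoint playable (n k r : nat) (x : position n) : bool :=
  if r is r'.+1 then has (playable k r') (options k x) else true.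

Lemma playableP (n k r : nat) (x : position n) :
  reflect (exists2 s : seq (position n), path (@move n k) x s & size s = r)
          (playable k r x).
Proof.
elim: r x => [|r IH] x /=; first by left; exists [::].
apply: (iffP hasP) => [[y]|[[|y s] //= /andP[xy ys] [sz]]].
  by rewrite mem_options => xy /IH[s ys <-]; exists (y :: s) => //=; rewrite xy.
by exists y; [rewrite mem_options | apply/IH; exists s].
Qed.

(* For [0 < k] a play from [x] has at most [\sum_i x i] moves, so the bound on
   [r] excludes nothing. *)
Definition tetris (n k : nat) (x : position n) : nat :=
  \max_(r < (\sum_i x i).+1 | playable k r x) r.

Lemma tetrisP (n k : nat) (x : position n) : 0 < k ->
  (exists2 s, path (@move n k) x s & size s = tetris k x) /\
  (forall s, path (@move n k) x s -> size s <= tetris k x).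
Proof.
move=> k_gt0; split.
  apply/playableP; rewrite /tetris.
  by apply: (big_ind (fun r => playable k r x)) => // r s;
    rewrite /maxn; case: ifP.
have bound s (z : position n) : path (@move n k) z s -> size s <= \sum_i z i.
  elim: s z => //= y s IH z /andP[zy /IH le_s].
  exact: leq_ltn_trans le_s (move_sum k_gt0 zy).
move=> s xs; have lt_s : size s < (\sum_i x i).+1 by rewrite ltnS bound.
apply: (@leq_bigmax_cond _ _ (@nat_of_ord _) (Ordinal lt_s)).
by apply/playableP; exists s.
Qed.

(* The default value makes this the true minimum as soon as there is a pile. *)
Definition min_pile (n : nat) (x : position n) : nat :=
  \big[minn/(\max_i x i)]_i x i.

Lemma min_pileP (n : nat) (x : position n) : 0 < n ->
  (exists i, min_pile x = x i) /\ (forall i, min_pile x <= x i).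
Proof.
move=> n_gt0; have lb i : min_pile x <= x i.
  rewrite /min_pile; move: (\max_i _) => M; have := mem_index_enum i.
  elim: (index_enum _) => // j r IH; rewrite inE big_cons geq_min.
  by case/predU1P=> [->|/IH ->]; rewrite ?leqnn ?orbT.
split=> //; rewrite /min_pile.
apply: (big_ind (fun m => exists i, m = x i)) => [|_ _ [i ->] [j ->]|i _].
- have [i ->] : {i | \max_i x i = x i} by apply: eq_bigmax; rewrite card_ord.
  by exists i.
- by rewrite /minn; case: ifP => _; [exists i | exists j].
- by exists i.
Qed.

(* Main.v *)
Require Import Defs.
From mathcomp Require Import all_boot all_order all_algebra.
From mathcomp Require Import zify.

(** The Sprague-Grundy function is the only function that changes along every
move and takes, on the options of a position, every smaller value
([sg_unique]); so it suffices to check these two properties for the claimed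
formula, called [value] below.

Everything rests on a counting formula for the Tetris function: [r] moves can
be made from [x] if and only if [k * r <= \sum_i minn (x i) r]
([leq_tetris]).  Necessity holds because each of the [r] moves takes a token
from [k] piles and no pile can be used more than [minn (x i) r] times;
sufficiency, because removing one token from each of the [k] largest piles
preserves the inequality.  It follows that removing one token lowers the Tetris
function by at most 1, whence an intermediate value property
([tetris_ivt_move]): between two moves on the same [k] piles, all intermediate
Tetris values are attained by moves on these piles.

Let [m] be the least pile of [x], let [e] be the Tetris value of [x] lowered by
[m] (the [excess]) and let [t = e (e + 1) / 2].  The position is small if
[m <= t], with value the Tetris function, and large otherwise, with a value in
the interval from [t] to [t + e], determined by [m] modulo [e + 1]; these
intervals partition the natural numbers as [e] varies.

A move changes the value ([value_move]).  Write [m'] and [e'] for the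
parameters of the option.  The Tetris function decreases strictly, which
settles moves between small positions.  The value of a large position is less
than its least pile, while the Tetris function is at least [2 * m + e], and the
[k] piles left alone by a move keep the Tetris function of the option at least
[m]; this settles moves between a small and a large position.  If both
positions are large with the same value, then [e' = e] and [m'] is congruent to
[m] modulo [e + 1].  But [m' = m] forces [e' < e], and otherwise
[m - m' >= e + 1], whereas the [k] piles left alone exceed [m'] by at least
[m - m'], so that [e' >= e + 1].

Every smaller value [g] is attained ([value_reach]).  The key is [reach]: every
[g] with [m <= g] below the Tetris function of [x] is the Tetris value of an
option which either has an empty pile or has its excess at least [e].  Such an
option of a small position is small, since its least pile is at most [m]; this
gives all [g >= m].  Applied to [x] lowered by [m - d], the same lemma gives
options with least pile exactly [m - d] and any excess [j] with
[d <= j <= e], apart from [d = 0] with [j = e] ([reach_min_excess]), and the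
freedom in [d] is enough to meet the congruence modulo [j + 1] which the value
[g < m] prescribes. *)

Set Implicit Arguments.
Unset Strict Implicit.
Unset Printing Implicit Defensive.

(** * Finite sets and least piles *)

Lemma sum_mem_card (T : finType) (A : {set T}) : \sum_i (i \in A : nat) = #|A|.
Proof.
rewrite -sum1_card [RHS]big_mkcond /=.
by apply: eq_bigr => i _; case: (i \in A).
Qed.

(** Choosing such a set avoids sorting the piles. *)
Lemma exists_top (T : finType) (f : T -> nat) (A : {set T}) r : r <= #|A| ->
  exists S : {set T}, [/\ S \subset A, #|S| = r &
    forall i j, i \in S -> j \in A -> j \notin S -> f j <= f i].
Proof.
elim: r => [|r IH] r_le.
  exists set0; split; rewrite ?sub0set ?cards0 // => i j.
  by rewrite inE.
have [S [SA cS topS]] := IH (ltnW r_le).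
have /card_gt0P[a0 a0A] : 0 < #|A :\: S| by rewrite cardsDS // cS subn_gt0.
have [a aA amax] := @arg_maxnP T a0 (mem (A :\: S)) f a0A.
move: aA; rewrite /= inE => /andP[aS aA].
exists (a |: S); split.
- by rewrite subUset sub1set aA.
- by rewrite cardsU1 aS cS.
move=> i j; rewrite !inE negb_or => /predU1P[-> | iS] jA /andP[_ jS].
  by apply: amax; rewrite /= inE jS.
exact: topS.
Qed.

Lemma min_pile_eq n (x : position n) i : (forall j, x i <= x j) -> min_pile x = x i.
Proof.
move=> x_min.
have [[j ->] le_m] := min_pileP x (leq_ltn_trans (leq0n i) (ltn_ord i)).
by apply/eqP; rewrite eqn_leq x_min andbT; have := le_m i; have := x_min j; lia.
Qed.

(** * The Tetris function *)

Section Tetris.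

Variables (n k : nat).
Implicit Types x y z : position n.

Lemma sum_minn_move r x y :
  move k x y -> k * r <= \sum_i minn (y i) r -> k * r.+1 <= \sum_i minn (x i) r.+1.
Proof.
move=> /andP[/forallP le_yx /eqP <-] le_r.
rewrite mulnS; apply: leq_trans (leq_add (leqnn _) le_r) _.
rewrite -sum_mem_card -big_split /=; apply: leq_sum => i _.
by rewrite inE; have := le_yx i; case: ltnP => /=; lia.
Qed.

Lemma sum_minn_ge (A : {set 'I_n}) r x :
  k <= #|A| -> {in A, forall i, r <= x i} -> k * r <= \sum_i minn (x i) r.
Proof.
move=> kA rA; apply: (@leq_trans (\sum_i (i \in A) * r)).
  by rewrite -big_distrl /= sum_mem_card leq_mul2r kA orbT.
apply: leq_sum => i _; case iA: (i \in A) => //.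
by rewrite mul1n leq_min leqnn rA.
Qed.

(** Taking one token from each pile of [S] costs [k] in the sum as long as the
piles outside [S] are not truncated.  If some of them are, the hypothesis
provides [k] piles larger than [r], and these suffice. *)
Lemma sum_minn_decr (S : {set 'I_n}) r x y :
    #|S| = k -> (forall i, x i <= y i + (i \in S)) ->
    (forall j, j \notin S -> r < x j -> k <= #|[set i | r < x i]|) ->
  k * r.+1 <= \sum_i minn (x i) r.+1 -> k * r <= \sum_i minn (y i) r.
Proof.
move=> cS le_xy topS le_r.
have [many|few] := leqP k #|[set i | r < x i]|.
  apply: sum_minn_ge many _ => i; rewrite inE.
  by have := le_xy i; case: (i \in S) => /=; lia.
suff: \sum_i minn (x i) r.+1 <= \sum_i ((i \in S) + minn (y i) r).
  rewrite big_split /= sum_mem_card cS => le_xyr.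
  by rewrite -(leq_add2l k) -mulnS (leq_trans le_r).
apply: leq_sum => i _; have := le_xy i.
case iS: (i \in S) => /=; first by lia.
by have := topS i; rewrite iS => /(_ isT); case: (ltnP r (x i)) => //; lia.
Qed.

(** At least [k] piles are nonempty, because every pile contributes at most
[r.+1] to the sum; so [k] largest piles are nonempty. *)
Lemma exists_top_pos r x : k * r.+1 <= \sum_i minn (x i) r.+1 ->
  exists S : {set 'I_n}, [/\ #|S| = k, {in S, forall i, 0 < x i} &
    forall i j, i \in S -> j \notin S -> x j <= x i].
Proof.
move=> le_r.
have pos_ge : k <= #|[set i | 0 < x i]|.
  rewrite -(@leq_pmul2r r.+1) //; apply: leq_trans le_r _.
  rewrite -sum_mem_card big_distrl /=; apply: leq_sum => i _.
  by rewrite inE; case: (x i) => [|a] /=; lia.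
have [|S [_ cS topS]] := @exists_top _ x [set: 'I_n] k.
  by rewrite (leq_trans pos_ge) // subset_leq_card.
exists S; split=> // [i iS|i j iS jS]; last exact: topS.
case: posnP => // x_i0; move: pos_ge.
suff sub: [set i | 0 < x i] \subset S :\ i.
  by rewrite leqNgt (leq_ltn_trans (subset_leq_card sub)) // -cS [ltnRHS](cardsD1 i) iS.
apply/subsetP=> j; rewrite !inE => x_j.
apply/andP; split; first by apply: contraTneq x_j => ->; rewrite x_i0.
by apply: contraLR x_j => jS; rewrite -leqNgt -x_i0 topS.
Qed.

Lemma playableE r x : playable k r x = (k * r <= \sum_i minn (x i) r).
Proof.
elim: r x => [|r IH] x /=; first by rewrite muln0.
apply/idP/idP => [/hasP[y]|le_r].
  by rewrite mem_options IH; apply: sum_minn_move.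
have [S [cS posS topS]] := exists_top_pos le_r.
pose y : position n := [ffun i => x i - (i \in S)].
apply/hasP; exists y.
  rewrite mem_options; apply/andP; split.
    by apply/forallP=> i; rewrite ffunE leq_subr.
  rewrite -cS; apply/eqP/eq_card => i; rewrite inE ffunE.
  by case iS: (i \in S); [have := posS i iS | ]; lia.
rewrite IH; apply: (sum_minn_decr cS _ _ le_r) => [i|j jS lt_rj].
  by rewrite ffunE; case: (_ \in S) => /=; lia.
rewrite -cS; apply/subset_leq_card/subsetP => i iS; rewrite inE.
exact: leq_trans lt_rj (topS _ _ iS jS).
Qed.

Hypothesis k_gt0 : 0 < k.

(** The counting formula for the Tetris function, through which the function is
used from here on. *)
Lemma leq_tetris r x : (r <= tetris k x) = (k * r <= \sum_i minn (x i) r).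
Proof.
have [[s xs sz] s_max] := tetrisP x k_gt0; rewrite -playableE.
apply/idP/playableP => [le_r|[s' xs' <-]]; last exact: s_max.
exists (take r s); last by rewrite size_takel ?sz.
by move: xs; rewrite -{1}(cat_take_drop r s) cat_path => /andP[].
Qed.

Lemma tetris_move x y : move k x y -> tetris k y < tetris k x.
Proof. by move=> xy; rewrite leq_tetris (sum_minn_move xy) // -leq_tetris. Qed.

Lemma tetris_mono x y : (forall i, x i <= y i) -> tetris k x <= tetris k y.
Proof.
move=> le_xy; rewrite leq_tetris.
apply: (@leq_trans (\sum_i minn (x i) (tetris k x))); first by rewrite -leq_tetris.
by apply: leq_sum => i _; have := le_xy i; lia.
Qed.

Lemma tetris_ge (A : {set 'I_n}) r x :
  k <= #|A| -> {in A, forall i, r <= x i} -> r <= tetris k x.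
Proof. by move=> kA rA; rewrite leq_tetris (sum_minn_ge kA). Qed.

(** If at most [k] piles are nonempty, all moves use the same piles, so none of
these can contain fewer tokens than there are moves. *)
Lemma tetris_le (A : {set 'I_n}) i x :
  #|A| <= k -> (forall j, j \notin A -> x j = 0) -> i \in A -> tetris k x <= x i.
Proof.
move=> Ak x0 iA; rewrite leqNgt leq_tetris -ltnNge.
apply: (@leq_trans (#|A| * (x i).+1)); last by rewrite leq_mul2r Ak orbT.
rewrite -sum_mem_card big_distrl /= (bigD1 i) //= [ltnRHS](bigD1 i) //= iA.
rewrite -addSn leq_add //; first by lia.
apply: leq_sum => j _; case jA: (j \in A); first by lia.
by rewrite x0 ?jA.
Qed.

(** Passing from [minn _ t.+1] to [minn _ t] lowers the sum by the number of
piles larger than [t].  Either there are [k] of them, and they alone bound the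
new sum, or there are at most [k.-1], which leaves room for the lost token. *)
Lemma tetris_lipschitz x y i :
  (forall j, x j <= y j + (j == i)) -> (tetris k x).-1 <= tetris k y.
Proof.
move=> le_xy; case def_t: (tetris k x) => [|t] //=.
have le_t : k * t.+1 <= \sum_i minn (x i) t.+1 by rewrite -leq_tetris def_t.
rewrite leq_tetris; have [many|few] := leqP k #|[set j | t < x j]|.
  apply: sum_minn_ge many _ => j; rewrite inE.
  by have := le_xy j; case: (j == i) => /=; lia.
suff: \sum_j minn (x j) t.+1
      <= \sum_j ((j \in [set i]) + (j \in [set j | t < x j]) + minn (y j) t).
  rewrite !big_split /= !sum_mem_card cards1; move: le_t few; rewrite mulnS.
  move: #|_| (\sum_j minn (x j) _) (\sum_j minn (y j) _) (k * t); clear; lia.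
apply: leq_sum => j _; rewrite !inE.
by have := le_xy j; case: (j == i); case: ltnP => /=; lia.
Qed.

(** Tokens are removed from [x] one by one until [y] is reached; no value is
skipped. *)
Lemma tetris_ivt g x y :
    (forall i, y i <= x i) -> tetris k y <= g <= tetris k x ->
  exists2 z : position n, (forall i, y i <= z i <= x i) & tetris k z = g.
Proof.
move: {2}(\sum_i x i) (leqnn (\sum_i x i)) => s.
elim: s x => [|s IH] x le_s le_yx /andP[yg gx].
  exists x => [i|]; first by rewrite le_yx leqnn.
  apply/eqP; rewrite eqn_leq gx andbT (leq_trans _ yg) // tetris_mono // => i.
  by move: le_s; rewrite leqn0 sum_nat_eq0 => /forallP/(_ i)/eqP->.
have [->|ng] := eqVneq g (tetris k x).
  by exists x => // i; rewrite le_yx leqnn.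
have [eq_xy|] := boolP [forall i, x i <= y i].
  have := @tetris_mono x y (forallP eq_xy); lia.
rewrite negb_forall => /existsP[i]; rewrite -ltnNge => lt_yx.
pose x' : position n := [ffun j => x j - (j == i)].
have lip : (tetris k x).-1 <= tetris k x'.
  by apply: (@tetris_lipschitz _ _ i) => j; rewrite ffunE; lia.
have [||| z le_z <-] := IH x'.
- rewrite -ltnS (leq_trans _ le_s) // (bigD1 i) // [ltnRHS](bigD1 i) //=.
  rewrite ffunE eqxx -addSn leq_add //; first by lia.
  by apply: leq_sum => j _; rewrite ffunE leq_subr.
- move=> j; rewrite ffunE; have := le_yx j.
  by case: (eqVneq j i) => [->|] /=; lia.
- by apply/andP; split=> //; lia.
by exists z => // j; have := le_z j; rewrite ffunE; lia.
Qed.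

(** As [a] and [b] arise from [x] by moves on the same set [S] of [k] piles, so
does everything between them. *)
Lemma tetris_ivt_move (S : {set 'I_n}) g x (a b : position n) :
    #|S| = k -> (forall i, b i <= a i) ->
    {in S, forall i, a i < x i} -> (forall i, i \notin S -> b i = x i) ->
    (forall i, a i <= x i) ->
    tetris k b <= g <= tetris k a ->
  exists y, [/\ move k x y, (forall i, b i <= y i <= a i) & tetris k y = g].
Proof.
move=> cS le_ba aS bS le_ax gab.
have [y le_y <-] := tetris_ivt le_ba gab; exists y; split=> //.
apply/andP; split; first by apply/forallP=> i; have := le_y i; have := le_ax i; lia.
rewrite -cS; apply/eqP/eq_card => i; rewrite inE; have := le_y i.
case iS: (i \in S); first by have := aS i iS; lia.
by have := bS i; rewrite iS => -> //; lia.
Qed.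

End Tetris.

Definition excess (n k : nat) (x : position n) : nat :=
  tetris k ([ffun i => x i - min_pile x] : position n).

(** * Options with a prescribed Tetris value *)

Section Reach.

Variable k : nat.
Hypothesis k_gt1 : 1 < k.
Let k_gt0 : 0 < k := ltnW k_gt1.
Local Notation pos := (position (2 * k)).
Implicit Types x y : pos.

Lemma pile_gt0 : 0 < 2 * k. Proof. by rewrite muln_gt0. Qed.

Lemma card_compl (S : {set 'I_(2 * k)}) : #|S| = k -> #|~: S| = k.
Proof. by have := cardsC S; rewrite card_ord; lia. Qed.

(** Take one token from each of [k] largest piles, then empty these piles: the
Tetris function goes from its greatest value on options down to 0, since at
most [k.-1] of the other [k] piles are nonempty. *)
Lemma reach_zero g x i : x i = 0 -> g < tetris k x ->
  exists2 y, move k x y & tetris k y = g.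
Proof.
move=> xi0 lt_g.
have := leqnn (tetris k x); rewrite -{1}(prednK (leq_ltn_trans (leq0n g) lt_g)).
rewrite leq_tetris // => le_t.
have [S [cS posS topS]] := exists_top_pos le_t.
pose a : pos := [ffun j => x j - (j \in S)].
pose b : pos := [ffun j => if j \in S then 0 else x j].
have iS : i \notin S by apply/negP => /posS; rewrite xi0.
have [|j jS|j jS|j||y [xy _ <-]] := @tetris_ivt_move _ _ k_gt0 S g x a b cS; last by exists y.
- by move=> j; rewrite !ffunE; case: (j \in S); lia.
- by rewrite ffunE jS; have := posS j jS; lia.
- by rewrite ffunE (negPf jS).
- by rewrite ffunE leq_subr.
apply/andP; split.
  apply: leq_trans (@tetris_le _ _ k_gt0 (~: S) i b _ _ _) _.
  - by rewrite card_compl.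
  - by move=> j; rewrite inE negbK ffunE => ->.
  - by rewrite inE.
  by rewrite ffunE (negPf iS) xi0.
apply: (@leq_trans (tetris k x).-1); first by lia.
rewrite leq_tetris //; apply: (sum_minn_decr cS _ _ le_t) => [j|j jS lt_j].
  by rewrite ffunE; case: (_ \in S) => /=; lia.
apply: (@leq_trans #|S|); first by rewrite cS.
apply/subset_leq_card/subsetP => h hS; rewrite inE.
exact: leq_trans lt_j (topS _ _ hS jS).
Qed.

(** Let [p] be a least pile, [L] a set of [k.-1] largest other piles, [b] a least
and [q] a largest of the [k] remaining piles.  Three families of options cover
the interval from the top down.

- Take one token from [p] and from each pile of [L], then empty [p].  The excess
  never drops below that of [x], because [p] stays the least pile and nothing
  else loses more than one token.

- With [p] empty, then empty [L].  At the end only the [k] remaining piles are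
  left, and the Tetris value is at most [x b].

- For the values from [m] to below [x b], use the piles of [L] and [q] instead.
  With [q] empty and one token taken from each pile of [L], all piles but [p]
  and [q] contain at least [x b - 1] tokens; these are [2 * k - 2], hence at
  least [k], piles as [k > 1].  When [L] is emptied, [p] is among the [k] piles
  left, and the Tetris value is at most [m]. *)
Lemma reach_pos g x : 0 < min_pile x -> min_pile x <= g < tetris k x ->
  exists y, [/\ move k x y, tetris k y = g &
    (exists i, y i = 0) \/ (excess k x < g /\ excess k x <= excess k y)].
Proof.
have [[p def_m] le_m] := min_pileP x pile_gt0.
rewrite /excess; move: (min_pile x) def_m le_m => m def_m le_m m_gt0 /andP[le_g lt_g].
have cp : #|[set~ p]| = (2 * k).-1.
  by have := cardsC1 p; rewrite card_ord.
have [|L [Lp cL topL]] := @exists_top _ x [set~ p] k.-1.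
  by rewrite cp; lia.
have pL : p \notin L by apply/negP=> /(subsetP Lp); rewrite !inE eqxx.
have top j i : i \in L -> j \notin L -> x j <= x i.
  move=> iL jL; have [->|jp] := eqVneq j p; first by rewrite -def_m le_m.
  by apply: topL => //; rewrite !inE.
have x_gt0 i : 0 < x i by apply: leq_trans (le_m i).
have le_t : k * g.+1 <= \sum_i minn (x i) g.+1 by rewrite -leq_tetris.
pose S1 := p |: L.
have cS1 : #|S1| = k by rewrite cardsU1 pL cL add1n prednK.
pose a1 : pos := [ffun i => x i - (i \in S1)].
pose a0 : pos := [ffun i => if i == p then 0 else x i - (i \in L)].
pose w : pos := [ffun i => x i - m].
have le_wa0 : tetris k w <= tetris k a0.
  apply: tetris_mono => // i; rewrite !ffunE; case: eqP => [->|_].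
    by rewrite -def_m subnn.
  by case: (i \in L) => /=; lia.
have a0_p : a0 p = 0 by rewrite ffunE eqxx.
have le_a0a1 i : a0 i <= a1 i.
  by rewrite !ffunE in_setU1; case: eqP => //= _; case: (i \in L).
have le_a1 i : a1 i <= x i by rewrite ffunE leq_subr.
have lt_a1 : {in S1, forall i, a1 i < x i}.
  by move=> i iS; rewrite ffunE iS; have := x_gt0 i; lia.
(* [a1] takes one token from every pile of [S1]; [a0] also empties [p], and still
   dominates the lowered position [w]. *)
have [g_hi|g_lo] := ltnP (tetris k a0) g.
  have Ta1 : g <= tetris k a1.
    rewrite leq_tetris //; apply: (sum_minn_decr cS1 _ _ le_t) => [i|j].
      by rewrite ffunE; case: (i \in S1) => /=; lia.
    rewrite in_setU1 negb_or => /andP[jp jL] lt_j.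
    apply: (@leq_trans #|j |: L|); first by rewrite cardsU1 jL cL; lia.
    apply/subset_leq_card/subsetP => i; rewrite !inE => /predU1P[->//|iL].
    exact: leq_trans lt_j (top _ _ iL jL).
  have [||y [xy le_y Ty]] :=
    @tetris_ivt_move _ _ k_gt0 S1 g x a1 a0 cS1 le_a0a1 lt_a1 _ le_a1.
  - by move=> i; rewrite in_setU1 negb_or ffunE => /andP[/negPf-> /negPf->]; rewrite subn0.
  - by rewrite Ta1 ltnW.
  exists y; split=> //; right; split; first exact: leq_ltn_trans le_wa0 _.
  have y_p : y p < m.
    by have /andP[_] := le_y p; rewrite ffunE setU11 def_m; have := x_gt0 p; lia.
  have y_ge i : i != p -> x i - 1 <= y i.
    by move=> /negPf ip; have /andP[+ _] := le_y i; rewrite ffunE ip; case: (_ \in _); lia.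
  have min_y : min_pile y = y p.
    apply: min_pile_eq => i; have [->//|ip] := eqVneq i p.
    by have := y_ge i ip; have := le_m i; lia.
  apply: tetris_mono => // i; rewrite !ffunE min_y.
  have [->|ip] := eqVneq i p; first by rewrite -def_m subnn.
  by have := y_ge i ip; lia.
pose B := ~: S1.
have cB : #|B| = k by apply: card_compl.
have [b0 b0B] : exists b0, b0 \in B by apply/card_gt0P; rewrite cB.
have [b bB minb] := @arg_minnP _ b0 (mem B) x b0B.
have [q qB maxq] := @arg_maxnP _ b0 (mem B) x b0B.
rewrite /= in bB minb qB maxq.
have inB i : i \in B = (i != p) && (i \notin L) by rewrite !inE negb_or.
have le_b i : i != p -> x b <= x i.
  move=> ip; have [iL|iL] := boolP (i \in L); last by apply: minb; rewrite /= inB ip.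
  by apply: top => //; move: bB; rewrite inB => /andP[].
(* Second and third families: [g] lies above or below [x b]. *)
have [c_lo|c_hi] := leqP (x b) g.
  pose z1 : pos := [ffun i => if i \in S1 then 0 else x i].
  have Tz1 : tetris k z1 <= x b.
    have -> : x b = z1 b by rewrite ffunE; move: bB; rewrite inE => /negPf ->.
    apply: (@tetris_le _ _ k_gt0 B); rewrite ?cB // => j.
    by rewrite inE negbK ffunE => ->.
  have [| | | | |y [xy le_y Ty]] := @tetris_ivt_move _ _ k_gt0 S1 g x a0 z1 cS1.
  - move=> i; rewrite !ffunE in_setU1; case: eqP => //= _.
    by case: (i \in L); rewrite ?subn0.
  - by move=> i iS; apply: leq_ltn_trans (le_a0a1 i) (lt_a1 i iS).
  - by move=> i iS; rewrite ffunE (negPf iS).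
  - by move=> i; apply: leq_trans (le_a0a1 i) (le_a1 i).
  - by rewrite g_lo (leq_trans Tz1).
  exists y; split=> //; left; exists p.
  by have /andP[_] := le_y p; rewrite a0_p leqn0 => /eqP.
have [qp qL] : q != p /\ q \notin L by move: qB; rewrite inB => /andP[].
pose S2 := q |: L.
have pS2 : p \notin S2 by rewrite in_setU1 negb_or eq_sym qp.
have cS2 : #|S2| = k by rewrite cardsU1 qL cL add1n prednK.
pose a2 : pos := [ffun i => if i == q then 0 else x i - (i \in L)].
pose z2 : pos := [ffun i => if i \in S2 then 0 else x i].
have Tz2 : tetris k z2 <= m.
  have -> : m = z2 p by rewrite ffunE (negPf pS2).
  apply: (@tetris_le _ _ k_gt0 (~: S2)); rewrite ?in_setC ?card_compl // => j.
  by rewrite inE negbK ffunE => ->.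
have Ta2 : g <= tetris k a2.
  apply: (@tetris_ge _ _ k_gt0 (~: [set p; q])).
    by rewrite cardsCs setCK cards2 eq_sym qp card_ord; move: k_gt1; clear; lia.
  move=> i; rewrite !inE negb_or => /andP[ip iq].
  rewrite ffunE (negPf iq); move: (leq_trans c_hi (le_b i ip)); clear.
  by case: (_ \in _) => /=; lia.
have [| | | | |y [xy le_y Ty]] := @tetris_ivt_move _ _ k_gt0 S2 g x a2 z2 cS2.
- move=> i; rewrite !ffunE in_setU1; case: eqP => //= _.
  by case: (i \in L); rewrite ?subn0.
- move=> i iS; rewrite ffunE; case: eqP iS => //= /eqP/negPf iq.
  by rewrite in_setU1 iq => /= ->; rewrite subn1 ltn_predL.
- by move=> i iS; rewrite ffunE (negPf iS).
- by move=> i; rewrite ffunE; case: eqP => // _; rewrite leq_subr.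
- by rewrite Ta2 (leq_trans Tz2).
exists y; split=> //; left; exists q.
by have /andP[_] := le_y q; rewrite [a2 q]ffunE eqxx leqn0 => /eqP.
Qed.

(** The second alternative covers the values that are too large for an option
with an empty pile. *)
Lemma reach g x : min_pile x <= g < tetris k x ->
  exists y, [/\ move k x y, tetris k y = g &
    (exists i, y i = 0) \/ (excess k x < g /\ excess k x <= excess k y)].
Proof.
move=> le_g; have [m0|] := posnP (min_pile x); last by move/reach_pos; apply.
have [[p]] := min_pileP x pile_gt0; rewrite m0 => /esym x_p _.
case/andP: le_g => _ /(reach_zero x_p)[y xy Ty]; exists y; split=> //; left.
by exists p; case/andP: xy => /forallP/(_ p); rewrite x_p leqn0 => /eqP.
Qed.

(** The [2 * k] piles contain two disjoint blocks of [m] moves each, below the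
[excess] moves of the lowered position. *)
Lemma excess_tetris x : 2 * min_pile x + excess k x <= tetris k x.
Proof.
have [_ le_m] := min_pileP x pile_gt0.
have := leqnn (excess k x); rewrite {2}/excess !leq_tetris // => le_e.
rewrite mulnDr mulnA [k * 2]mulnC; apply: leq_trans (leq_add (leqnn _) le_e) _.
rewrite -[X in X * min_pile x]card_ord -sum_nat_const -big_split /=.
by apply: leq_sum => i _; rewrite ffunE; have := le_m i; lia.
Qed.

Lemma move_unmoved x y : move k x y ->
  exists2 A : {set 'I_(2 * k)}, #|A| = k & {in A, forall i, y i = x i}.
Proof.
case/andP=> /forallP le_yx /eqP cS; exists (~: [set i | y i < x i]).
  exact: card_compl.
by move=> i; rewrite !inE -leqNgt => le_xy; apply/eqP; rewrite eqn_leq le_yx.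
Qed.

Lemma move_min_tetris x y : move k x y -> min_pile x <= tetris k y.
Proof.
have [_ le_m] := min_pileP x pile_gt0.
by case/move_unmoved=> A cA eqA; apply: (tetris_ge _ (A := A)); rewrite ?cA // => i /eqA ->.
Qed.

Lemma move_min_excess x y : move k x y -> min_pile x - min_pile y <= excess k y.
Proof.
have [_ le_m] := min_pileP x pile_gt0.
case/move_unmoved=> A cA eqA; apply: (tetris_ge _ (A := A)); rewrite ?cA // => i iA.
by rewrite ffunE (eqA i iA) leq_sub2r.
Qed.

Lemma move_min x y : move k x y -> min_pile y <= min_pile x.
Proof.
have [[p ->] _] := min_pileP x pile_gt0.
have [_ le_m] := min_pileP y pile_gt0.
by case/andP=> /forallP le_yx _; apply: leq_trans (le_yx p).
Qed.

(** With the same least pile, the move is also a move between the lowered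
positions. *)
Lemma move_excess x y :
  move k x y -> min_pile y = min_pile x -> excess k y < excess k x.
Proof.
move=> /andP[/forallP le_yx /eqP cS] eq_m; rewrite /excess eq_m.
have [_ le_m] := min_pileP y pile_gt0.
apply: tetris_move => //; apply/andP; split.
  by apply/forallP=> i; rewrite !ffunE leq_sub2r.
apply/eqP; rewrite -[RHS]cS; apply/eq_card => i; rewrite !inE !ffunE -eq_m.
by have := le_m i; lia.
Qed.

Definition raise c x : pos := [ffun i => x i + c].

Lemma min_raise c x i : x i = 0 -> min_pile (raise c x) = c.
Proof.
by move=> x_i; rewrite (@min_pile_eq _ _ i) => [|j]; rewrite !ffunE x_i ?leq_addl.
Qed.

Lemma excess_raise c x i : x i = 0 -> excess k (raise c x) = tetris k x.
Proof.
move=> x_i; rewrite /excess (min_raise c x_i); congr tetris.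
by apply/ffunP=> j; rewrite !ffunE addnK.
Qed.

(** Lower [x] until its least pile is [d], apply [reach] to find an option with
Tetris value [j] there, and raise the result back.  As [j <= excess k x], the
option found has an empty pile. *)
Lemma reach_min_excess d j x :
    d <= j <= excess k x -> d <= min_pile x -> (0 < d) || (j < excess k x) ->
  exists y, [/\ move k x y, min_pile y = min_pile x - d & excess k y = j].
Proof.
move=> /andP[le_dj le_j] le_d ne.
have [[p def_m] le_m] := min_pileP x pile_gt0.
pose c := min_pile x - d.
pose x' : pos := [ffun i => x i - c].
have min_x' : min_pile x' = d.
  rewrite (@min_pile_eq _ _ p) => [|i]; rewrite !ffunE -def_m ?leq_sub2r //.
  by rewrite subKn.
have ex_x' : excess k x' = excess k x.
  by congr tetris; apply/ffunP=> i; rewrite min_x' !ffunE -subnDA subnK.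
have [|y [xy Ty zy]] := @reach j x'.
  by rewrite min_x' le_dj; have := excess_tetris x'; rewrite min_x' ex_x'; lia.
have [i y_i] : exists i, y i = 0.
  by case: zy => // -[]; rewrite ex_x' ltnNge le_j.
exists (raise c y); split; last by rewrite (excess_raise c y_i).
  case/andP: xy => /forallP le_yx /eqP cS; apply/andP; split.
    apply/forallP=> h; have := le_yx h; have := le_m h.
    by rewrite !ffunE /c; lia.
  apply/eqP; rewrite -[RHS]cS; apply/eq_card => h; rewrite !inE !ffunE.
  by have := le_m h; rewrite /c; lia.
exact: min_raise y_i.
Qed.

End Reach.

(** * Triangular numbers and the characterisation of the Grundy function *)

Definition triangular y := 'C(y.+1, 2).

Lemma triangularS y : triangular y.+1 = triangular y + y.+1.
Proof. by rewrite /triangular binS bin1. Qed.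

Lemma leq_triangular y y' : y <= y' -> triangular y <= triangular y'.
Proof. by move=> le_y; rewrite leq_bin2l. Qed.

Lemma triangular_level g : exists j, triangular j <= g < triangular j.+1.
Proof.
elim: g => [|g [j /andP[le_g lt_g]]]; first by exists 0.
have [lt_g1|] := ltnP g.+1 (triangular j.+1); first by exists j; rewrite lt_g1 leqW.
by exists j.+1; rewrite [triangular j.+2]triangularS; lia.
Qed.

Lemma triangular_inj y r y' r' : r <= y -> r' <= y' ->
  triangular y + r = triangular y' + r' -> y = y' /\ r = r'.
Proof.
move=> le_r le_r' eq_yr; suff eq_y : y = y' by move: eq_yr; rewrite eq_y; lia.
have [lt_y|lt_y|//] := ltngtP y y'; have := leq_triangular lt_y;
  by rewrite triangularS; lia.
Qed.

Lemma sg_unique n k (F : position n -> nat) : 0 < k ->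
    (forall x y, move k x y -> F y <> F x) ->
    (forall x g, g < F x -> exists2 y, move k x y & F y = g) ->
  forall x, sg k x = F x.
Proof.
move=> k_gt0 F_ne F_reach x.
move: {2}(\sum_i x i).+1 (ltnSn (\sum_i x i)) => s.
elim: s x => // s IH x; rewrite ltnS => le_s.
have sgF y : move k x y -> sg k y = F y.
  by move=> xy; apply: IH; apply: leq_trans (move_sum k_gt0 xy) le_s.
rewrite sgE // /mex; case: ex_minnP => v v_notin v_min.
apply/eqP; rewrite eqn_leq; apply/andP; split.
  apply: v_min; apply/mapP=> -[y]; rewrite mem_options => xy eqF.
  by apply: (F_ne x y xy); rewrite -sgF.
rewrite leqNgt; apply: contra v_notin => /F_reach[y xy <-].
by apply/mapP; exists y; rewrite ?mem_options ?sgF.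
Qed.

(** * The Grundy function of the game on twice as many piles *)

Section Value.

Variable k : nat.
Hypothesis k_gt1 : 1 < k.
Let k_gt0 : 0 < k := ltnW k_gt1.
Local Notation pos := (position (2 * k)).
Implicit Types x y : pos.

(** Truncated subtraction agrees with the integer residue, as [t.+1 <= m] when
the second branch is taken. *)
Definition value x : nat :=
  let m := min_pile x in let t := triangular (excess k x) in
  if m <= t then tetris k x else t + (m - t.+1) %% (excess k x).+1.

Lemma value_small x : min_pile x <= triangular (excess k x) -> value x = tetris k x.
Proof. by rewrite /value => ->. Qed.

Lemma value_large x : triangular (excess k x) < min_pile x ->
  exists2 r, r <= excess k x & value x = triangular (excess k x) + r
    /\ min_pile x = triangular (excess k x) + r + 1 %[mod (excess k x).+1].
Proof.
rewrite /value; set t := triangular _; set m := min_pile x => lt_t.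
exists ((m - t.+1) %% (excess k x).+1); first by rewrite -ltnS ltn_mod.
rewrite ifN -?ltnNge //; split=> //.
by rewrite addnAC modnDmr addn1 subnKC.
Qed.

Lemma value_lt_min x : triangular (excess k x) < min_pile x -> value x < min_pile x.
Proof.
move=> lt_t; rewrite /value ifN -?ltnNge //.
have := leq_mod (min_pile x - (triangular (excess k x)).+1) (excess k x).+1; lia.
Qed.

(** The value of a large position determines its excess and, modulo
[(excess k x).+1], its least pile. *)
Lemma value_move x y : move k x y -> value y <> value x.
Proof.
move=> xy; have lt_T := tetris_move k_gt0 xy.
have [small_x|large_x] := leqP (min_pile x) (triangular (excess k x)).
  rewrite (value_small small_x).
  have [/value_small -> | large_y] := leqP (min_pile y) (triangular (excess k y)).
    by move=> eqT; rewrite eqT ltnn in lt_T.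
  have := value_lt_min large_y; have := excess_tetris k_gt1 y; lia.
have [small_y|large_y] := leqP (min_pile y) (triangular (excess k y)).
  rewrite (value_small small_y).
  by have := value_lt_min large_x; have := move_min_tetris k_gt1 xy; lia.
have [r le_r [-> mod_x]] := value_large large_x.
have [r' le_r' [-> mod_y]] := value_large large_y.
case/(triangular_inj le_r' le_r) => eq_e eq_r.
have := move_min k_gt1 xy; rewrite leq_eqVlt => /predU1P[/(move_excess k_gt1 xy)|lt_m].
  by rewrite eq_e ltnn.
have : (excess k x).+1 %| min_pile x - min_pile y.
  by rewrite -eqn_mod_dvd ?(ltnW lt_m) // mod_x -eq_r -eq_e mod_y.
move/dvdn_leq; rewrite subn_gt0 => /(_ lt_m).
by have := move_min_excess k_gt1 xy; rewrite eq_e; lia.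
Qed.

(** Below the least pile, the option is large: its excess is the index [j] of the
triangular interval containing [g], and [d] is chosen so that its least pile is
congruent to [g.+1] modulo [j.+1].  From the least pile on, [x] is small and
the option provided by [reach] is small as well. *)
Lemma value_reach x g : g < value x -> exists2 y, move k x y & value y = g.
Proof.
move=> lt_g; have [lt_gm|le_mg] := ltnP g (min_pile x).
  have [j /andP[le_j lt_j]] := triangular_level g.
  pose d := (min_pile x - g.+1) %% j.+1.
  have le_dj : d <= j by rewrite -ltnS ltn_mod.
  have le_dm : d <= min_pile x - g.+1 by apply: leq_mod.
  have value_y y : min_pile y = min_pile x - d -> excess k y = j -> value y = g.
    rewrite /value => -> ->; rewrite ifN; last by rewrite -ltnNge; lia.
    have -> : min_pile x - d - (triangular j).+1
        = (min_pile x - g.+1) %/ j.+1 * j.+1 + (g - triangular j).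
      by have := divn_eq (min_pile x - g.+1) j.+1; rewrite -/d; lia.
    rewrite modnMDl modn_small; first by lia.
    by move: lt_j; rewrite triangularS; lia.
  have le_je : j <= excess k x.
    rewrite leqNgt; apply/negP => /leq_triangular; rewrite triangularS => lt_e.
    have large : triangular (excess k x) < min_pile x by lia.
    have [r le_r [val _]] := value_large large; lia.
  have [|||y [xy min_y ex_y]] := @reach_min_excess k k_gt1 d j x.
  - by rewrite le_dj.
  - lia.
  (* If no pile had to be lowered and [j] were the excess of [x], then [x] itself
     would have value [g]. *)
  - rewrite [j < _]ltn_neqAle le_je andbT; case: posnP => //= d0.
    apply/eqP=> eq_j; have := @value_y x; rewrite d0 subn0 => /(_ erefl (esym eq_j)).
    by lia.
  by exists y => //; apply: value_y.
have small_x : min_pile x <= triangular (excess k x).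
  by rewrite leqNgt; apply/negP => /value_lt_min; lia.
move: lt_g; rewrite value_small // => lt_g.
have [|y [xy <- zy]] := @reach k k_gt1 g x; first by rewrite le_mg.
exists y => //; apply: value_small; case: zy => [[i y_i]|[_ le_e]].
  by have [_ /(_ i)] := min_pileP y (pile_gt0 k_gt1); rewrite y_i leqn0 => /eqP ->.
exact: leq_trans (move_min k_gt1 xy) (leq_trans small_x (leq_triangular le_e)).
Qed.

End Value.

Theorem theorem2 (k : nat) (hk : 2 <= k) (x : position (2 * k)) :
  let u := tetris k x in
  let m := min_pile x in
  let y := tetris k ([ffun i => x i - m] : position (2 * k)) in
  let z := 1 + 'C(y + 1, 2) in
  let v := (z - 1) + `|((m%:Z - z%:Z)%R %% (y + 1)%N%:Z)%Z|%N in
  sg k x = if m < z then u else v.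
Proof.
move=> u m y z v.
rewrite (sg_unique (ltnW hk) (value_move hk) (value_reach hk)).
rewrite /value -/m -/u -[excess k x]/y /triangular /v /z addn1 add1n ltnS.
by case: leqP => // lt_m; rewrite subn1 subzn // modz_nat absz_nat.
Qed.
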